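(* Let $S$ be a $\prec$-distributive $\vee$-predomain. Then for all $p,q\in S$, \[p\prec q\qquad\Leftrightarrow\qquad\widehat{S}_p\Subset\widehat{S}_q.\]
   Context: $(S,\leq)$ is a $\vee$-semilattice (poset with binary joins $\vee$) with minimum $0$, equipped with a binary relation $\prec$. A filter is a non-empty $F\subseteq S$ such that for all $p,q\in S$: $p,q\in F$ iff there is $r\in F$ with $r\leq p,q$. An ideal is a non-empty $I\subseteq S$ such that for all $p,q\in S$: $p,q\in I$ iff there is $r\in I$ with $r\geq p,q$. A filter $P$ is prime if $S\setminus P$ is an ideal; proper if $P\neq S$; round if for every $p\in P$ there is $r\in P$ with $r\prec p$. The spectrum of $(S,\leq,\prec)$ is the set $\widehat{S}$ of all proper round prime filters, with the topology generated by the sets $\widehat{S}_p=\{P\in\widehat{S}:p\in P\}$, $p\in S$. $\prec$ is distributive if for all $p,s,t\in S$: $p\prec s\vee t$ implies that for every $p'\prec p$ there are $s'\prec s$ and $t'\prec t$ with $p'\leq s'\vee t'\leq p$. $\prec$ is auxiliary if for all $p,p',q,q'\in S$: $p\leq p'\prec q'\leq q$ implies $p\prec q$, and $p\prec q$ implies $p\leq q$. $\prec$ is interpolative if whenever $p\prec q$ there is $s\in S$ with $p\prec s\prec q$. $\prec$ is approximating if for all $p,q\in S$: $p\leq q$ iff $\{r\in S:r\prec p\}\subseteq\{r\in S:r\prec q\}$. $\prec$ is $\vee$-preserving if for all $p,p',q,q'\in S$: $p'\prec p$ and $q'\prec q$ imply $p'\vee q'\prec p\vee q$. $S$ is a $\vee$-predomain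 if $\prec$ is auxiliary, approximating, interpolative and $\vee$-preserving; it is a $\prec$-distributive $\vee$-predomain if moreover $\prec$ is distributive. For open subsets $O,N$ of a topological space (here $\widehat{S}$), $O\Subset N$ means every open cover of $N$ has a finite subfamily covering $O$.
   Formalization: It is additionally assumed that p ≺ q holds for at least one pair; this excludes only S = {0} with ≺ empty, where all the axioms hold vacuously, the spectrum is empty, and Ŝ_0 ⋐ Ŝ_0 holds although 0 ≺ 0 fails. *)

(* Defs.v *)
From HB Require Import structures.
From mathcomp Require Import all_boot all_order.
From mathcomp Require Import all_classical topology.

Set Implicit Arguments.
Unset Strict Implicit.
Unset Printing Implicit Defensive.

Import Order.Theory.

Local Open Scope classical_set_scope.
Local Open Scope order_scope.

Section FiltersAndIdeals.
Context {d : Order.disp_t} {S : bJoinSemilatticeType d}.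

(* Only [S] is assumed to have joins, so both conditions are biconditionals:
   left to right is directedness, right to left is closure under [<=] (resp.
   [>=]).  Unrelated to [filter.Filter], which is about sets of subsets. *)
Definition order_filter (F : set S) : Prop :=
  F !=set0 /\
  forall p q : S, (F p /\ F q) <-> exists2 r, F r & (r <= p) /\ (r <= q).

Definition order_ideal (I : set S) : Prop :=
  I !=set0 /\
  forall p q : S, (I p /\ I q) <-> exists2 r, I r & (p <= r) /\ (q <= r).

Definition prime_filter (P : set S) : Prop :=
  order_filter P /\ order_ideal (~` P).

Definition proper_subset (P : set S) : Prop := P <> setT.

Definition round (prec : S -> S -> Prop) (P : set S) : Prop :=
  forall p, P p -> exists2 r, P r & prec r p.

End FiltersAndIdeals.

Section Predomains.
Context {d : Order.disp_t} {S : bJoinSemilatticeType d}.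
Variable prec : S -> S -> Prop.
Local Notation "p ≺ q" := (prec p q) (at level 70, no associativity).

Definition prec_distributive : Prop :=
  forall p s t : S, p ≺ (s `|` t)%O ->
  forall p', p' ≺ p ->
  exists s' t', [/\ s' ≺ s, t' ≺ t, p' <= (s' `|` t')%O & (s' `|` t')%O <= p].

Definition auxiliary : Prop :=
  (forall p p' q' q : S, p <= p' -> p' ≺ q' -> q' <= q -> p ≺ q) /\
  (forall p q : S, p ≺ q -> p <= q).

Definition interpolative : Prop :=
  forall p q : S, p ≺ q -> exists2 s, p ≺ s & s ≺ q.

Definition approximating : Prop :=
  forall p q : S, p <= q <-> [set r | r ≺ p] `<=` [set r | r ≺ q].

Definition join_preserving : Prop :=
  forall p p' q q' : S, p' ≺ p -> q' ≺ q -> (p' `|` q')%O ≺ (p `|` q)%O.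

Definition join_predomain : Prop :=
  [/\ auxiliary, approximating, interpolative & join_preserving].

Definition distributive_join_predomain : Prop :=
  join_predomain /\ prec_distributive.

End Predomains.

Section Spectrum.
Context {d : Order.disp_t} {S : bJoinSemilatticeType d}.
Variable prec : S -> S -> Prop.

Definition spectrum : Type :=
  set_type [set P : set S | [/\ proper_subset P, round prec P & prime_filter P]].

HB.instance Definition _ := Choice.on spectrum.

Definition spectrum_at (p : S) : set spectrum := [set P | (\val P : set S) p].

(* [id] on [range spectrum_at], rather than [spectrum_at] on [S], because the
   factory asks for a pointed index type. *)
HB.instance Definition _ :=
  isSubBaseTopological.Build spectrum (range spectrum_at) id.

End Spectrum.

Arguments spectrum_at {d S} prec p.

(* The finite subfamily [F] may be empty, which matters when [O] is. *)
Definition way_inside (T : topologicalType) (O N : set T) : Prop :=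
  forall C : set (set T),
    (forall U, C U -> open U) -> N `<=` \bigcup_(U in C) U ->
  exists F : set (set T),
    [/\ finite_set F, F `<=` C & O `<=` \bigcup_(U in F) U].

(* Main.v *)
(** A cover of [spectrum_at prec q] defines the ideal of those [x] whose basic
    open set is finitely covered.  If [p] were outside this ideal, iterating
    interpolation between [p] and [q] would give a round filter through [q]
    that is disjoint from it.  Zorn's lemma enlarges the ideal to a maximal one
    disjoint from the filter; distributivity makes its complement a round prime
    filter, that is, a point of [spectrum_at prec q] that is not covered.
    Conversely, the sets [spectrum_at prec r] with [r] below [q] for [prec]
    cover [spectrum_at prec q] by roundness; a finite subcover gives a single
    such [r], and separating [r] from [p] in the same way gives [p <= r]. *)
Require Import Defs.
From mathcomp Require Import all_boot all_order.
From mathcomp Require Import finmap all_classical topology.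

Set Implicit Arguments.
Unset Strict Implicit.
Unset Printing Implicit Defensive.

Import Order.Theory.

Local Open Scope order_scope.
Local Open Scope classical_set_scope.

(** * Ideals and filters in a join-semilattice with minimum *)

Section FiltersAndIdeals.
Context {d : Order.disp_t} {S : bJoinSemilatticeType d}.
Implicit Types (F I : set S) (x y : S).

Lemma order_idealP I : order_ideal I <->
  [/\ I \bot, forall x y, x <= y -> I y -> I x &
      forall x y, I x -> I y -> I (x `|` y)%O].
Proof.
split=> [[[z Iz] IP]|[I0 Ile IU]].
  have Ile x y : x <= y -> I y -> I x.
    by move=> xy Iy; have [] := (IP x x).2 (ex_intro2 _ _ y Iy (conj xy xy)).
  split=> // [|x y Ix Iy]; first exact: Ile (le0x z) Iz.
  have [r Ir [xr yr]] := (IP x y).1 (conj Ix Iy).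
  by apply: Ile Ir; rewrite leUx xr.
split=> [|x y]; first by exists \bot.
split=> [[Ix Iy]|[r Ir [xr yr]]].
  by exists (x `|` y)%O; [exact: IU|rewrite leUl leUr].
by split; [exact: Ile Ir|exact: Ile Ir].
Qed.

Lemma order_filterP F : order_filter F <->
  [/\ F !=set0, forall x y, x <= y -> F x -> F y &
      forall x y, F x -> F y -> exists2 r, F r & (r <= x) /\ (r <= y)].
Proof.
split=> [[F0 FP]|[F0 Fle FI]].
  split=> // x y => [xy Fx|Fx Fy]; last exact: (FP x y).1 (conj Fx Fy).
  by have [] := (FP y y).2 (ex_intro2 _ _ x Fx (conj xy xy)).
split=> // x y; split=> [[Fx Fy]|[r Fr [rx ry]]]; first exact: FI.
by split; [exact: Fle rx Fr|exact: Fle ry Fr].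
Qed.

Lemma ideal_adjoin I x : order_ideal I ->
  order_ideal [set z | exists2 j, I j & z <= (j `|` x)%O].
Proof.
move=> /order_idealP[I0 Ile IU]; apply/order_idealP; split.
- by exists \bot; rewrite ?le0x.
- by move=> y z yz [j Ij zj]; exists j => //; exact: le_trans yz zj.
move=> y z [j Ij yj] [k Ik zk]; exists (j `|` k)%O; first exact: IU.
by rewrite leUx (le_trans yj) ?(le_trans zk) // leU2 // ?leUl ?leUr.
Qed.

(** By maximality, the ideal generated by [J] and any [x] outside it meets [F]; the last clause
    records this, the form in which maximality is used below. *)
Lemma maximal_disjoint_ideal I F : order_ideal I -> order_filter F ->
  (forall x, I x -> ~ F x) ->
  exists J, [/\ order_ideal J, I `<=` J, forall x, J x -> ~ F x &
    forall x, ~ J x -> exists2 j, J j & F (j `|` x)%O].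
Proof.
move=> idI /order_filterP[F0 Fle FI] IF.
(* [I] is adjoined to the sets [X] so that the empty chain needs no case. *)
pose good (X : set S) :=
  order_ideal (I `|` X) /\ forall x, (I `|` X) x -> ~ F x.
have [|A [[idJ JF] maxA]] := @Zorn_bigcup _ good.
  move=> C Cgood Ctot; split; last first.
    move=> x [Ix|[X CX Xx]]; first exact: IF.
    by apply: (Cgood X CX).2; right.
  have [I0 Ile IU] := (order_idealP _).1 idI.
  apply/order_idealP; split; first by left.
    move=> x y xy [Iy|[X CX Xy]]; first by left; exact: Ile Iy.
    have [_ Xle _] := (order_idealP _).1 (Cgood X CX).1.
    by have [|] := Xle x y xy (or_intror Xy); [left|right; exists X].
  (* Members of a chain are nested, so any two elements of the union lie together in [I] joined to a
     single member. *)
  have inC X x y : C X -> (I `|` X) x -> (I `|` X) y ->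
      (I `|` \bigcup_(Y in C) Y) (x `|` y)%O.
    move=> CX Xx Xy.
    have [_ _ /(_ _ _ Xx Xy)] := (order_idealP _).1 (Cgood X CX).1.
    by case; [left|right; exists X].
  move=> x y [Ix|[X CX Xx]] [Iy|[Y CY Yy]].
  - by left; exact: IU.
  - by apply: (inC Y) => //; [left|right].
  - by apply: (inC X) => //; [right|left].
  have [XY|YX] := Ctot _ _ CX CY.
    by apply: (inC Y) => //; right => //; exact: XY.
  by apply: (inC X) => //; right => //; exact: YX.
exists (I `|` A); split => // x nJx.
apply: contrapT => noj.
have [J0 _ _] := (order_idealP _).1 idJ.
pose K := [set z | exists2 j, (I `|` A) j & z <= (j `|` x)%O].
have JK : I `|` A `<=` K by move=> z Jz; exists z => //; exact: leUl.
have IKE : I `|` K = K.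
  by apply/seteqP; split=> z; [case=> [Iz|//]; apply: JK; left|right].
apply: (maxA K).
  split; first by move=> z Az; apply: JK; right.
  by move=> KA; apply: nJx; right; apply: KA; exists \bot; rewrite ?leUr.
rewrite /good IKE; split; first exact: ideal_adjoin.
by move=> z [j Jj zj] Fz; apply: noj; exists j => //; exact: Fle zj Fz.
Qed.

End FiltersAndIdeals.

(** * Separating an ideal from a point of the spectrum *)

Section Spectrum.
Context {d : Order.disp_t} {S : bJoinSemilatticeType d}.
Variable prec : S -> S -> Prop.
Local Notation "p ≺ q" := (prec p q) (at level 70, no associativity).

(** [F] is the up-closure of a sequence [q = s 0], [s 1 ≺ s 0], [s 2 ≺ s 1], ... with [p ≺ s n]
    throughout. *)
Lemma interpolating_round_filter p q :
  auxiliary prec -> interpolative prec -> p ≺ q ->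
  exists F : set S, [/\ order_filter F, round prec F, F q &
    forall x, F x -> p <= x].
Proof.
move=> [aux precW] itp pq.
have [f fP] : {f & forall x, p ≺ x -> p ≺ f x /\ f x ≺ x}.
  apply: (@choice _ _ (fun x y => p ≺ x -> p ≺ y /\ y ≺ x)) => x.
  (* [x] is a dummy value when [p ≺ x] fails. *)
  by have [/itp[y py yx]|npx] := pselect (p ≺ x); [exists y|exists x].
pose s n := iter n f q.
have ps n : p ≺ s n by elim: n => // n /fP[].
have sS n : s n.+1 ≺ s n by have [] := fP _ (ps n).
have s_anti m n : s (m + n) <= s n.
  by elim: m => // m; apply: le_trans; exact: precW (sS _).
exists [set x | exists n, s n <= x]; split.
- apply/order_filterP; split; first by exists q; exists 0.
    by move=> x y xy [n nx]; exists n; exact: le_trans nx xy.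
  move=> x y [m mx] [n ny]; exists (s (m + n)); first by exists (m + n).
  by split; [rewrite addnC; exact: le_trans mx|exact: le_trans ny].
- move=> x [n nx]; exists (s n.+1); first by exists n.+1.
  by apply: aux nx => //; exact: sS.
- by exists 0.
- by move=> x [n]; apply: le_trans; exact: precW (ps n).
Qed.

Lemma compl_maximal_ideal_round_prime (F J : set S) :
  auxiliary prec -> prec_distributive prec ->
  order_filter F -> round prec F -> order_ideal J ->
  (forall x, J x -> ~ F x) ->
  (forall x, ~ J x -> exists2 j, J j & F (j `|` x)%O) ->
  round prec (~` J) /\ prime_filter (~` J).
Proof.
move=> [aux precW] distr /order_filterP[[f Ff] Fle FI] rF idJ JF maxJ.
have [J0 Jle JU] := (order_idealP _).1 idJ.
(* Distributivity gives [c' <= v ∨ u <= c] with [v ≺ j] and [u ≺ x]. Since [v] is in [J], having [u]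
   in [J] would put [c'] there too. *)
have shrink x j c c' : J j -> ~ J c' -> c' ≺ c -> c ≺ (j `|` x)%O ->
    exists u, [/\ ~ J u, u ≺ x & u <= c].
  move=> Jj nJc' c'c cjx.
  have [v [u [vj ux c'vu vuc]]] := distr _ _ _ cjx _ c'c.
  exists u; split=> // [Ju|]; last exact: le_trans (leUr _ _) vuc.
  apply: nJc'; apply: (Jle _ _ c'vu); apply: JU => //.
  exact: Jle (precW _ _ vj) Jj.
have below x j r : J j -> F r -> r <= (j `|` x)%O ->
    exists u, [/\ ~ J u, u ≺ x & u ≺ r].
  move=> Jj Fr rjx.
  (* Two steps of roundness: [r1] is [≺]-below [j ∨ x], [r2] is a witness below it outside [J], and
     [u <= r1 ≺ r] yields [u ≺ r]. *)
  have [r1 Fr1 r1r] := rF _ Fr; have [r2 Fr2 r2r1] := rF _ Fr1.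
  have nJr2 : ~ J r2 by move=> /JF.
  have r1jx : r1 ≺ (j `|` x)%O by exact: aux (lexx _) r1r rjx.
  have [u [nJu ux ur1]] := shrink x j r1 r2 Jj nJr2 r2r1 r1jx.
  by exists u; split => //; exact: aux ur1 r1r (lexx _).
have rJ : round prec (~` J).
  move=> x /maxJ[j Jj Fjx].
  by have [u [nJu ux _]] := below x j _ Jj Fjx (lexx _); exists u.
split=> //; split; last by rewrite setCK.
apply/order_filterP; split.
- by exists f => /JF.
- by move=> x y xy nJx Jy; apply: nJx; exact: Jle xy Jy.
move=> x y /maxJ[j Jj Fjx] /maxJ[k Jk Fky].
have [r Fr [rjx rky]] := FI _ _ Fjx Fky.
(* The joins are split one after the other: [s] comes from [j ∨ x], then takes the place of [r] for
   [k ∨ y]. As [s] need not lie in [F], the witness [s'] comes from the roundness just proved. *)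
have [s [nJs sx sr]] := below x j r Jj Fr rjx.
have [s' nJs' s's] := rJ _ nJs.
have sky : s ≺ (k `|` y)%O by exact: aux (lexx _) sr rky.
have [u [nJu uy us]] := shrink y k s s' Jk nJs' s's sky.
exists u => //; split; last exact: precW.
exact: le_trans us (precW _ _ sx).
Qed.

(** Applied below to the ideal of finitely covered elements and to principal ideals. *)
Lemma spectrum_at_avoiding_ideal p q (I : set S) :
  auxiliary prec -> interpolative prec -> prec_distributive prec ->
  order_ideal I -> p ≺ q -> ~ I p ->
  exists2 P : spectrum prec, spectrum_at prec q P &
    forall x, I x -> ~ spectrum_at prec x P.
Proof.
move=> aux itp distr idI pq nIp.
have [F [fF rF Fq Fp]] := interpolating_round_filter aux itp pq.
have IF x : I x -> ~ F x.
  move=> Ix /Fp px; apply: nIp.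
  by have [_ + _] := (order_idealP I).1 idI; apply; [exact: px|].
have [J [idJ IJ JF maxJ]] := maximal_disjoint_ideal idI fF IF.
have [rJ pJ] := compl_maximal_ideal_round_prime aux distr fF rF idJ JF maxJ.
have prJ : proper_subset (~` J).
  have [J0 _ _] := (order_idealP J).1 idJ.
  by move=> JT; suff : (~` J) \bot by []; rewrite JT.
have specJ : ~` J \in
    [set P : set S | [/\ proper_subset P, round prec P & prime_filter P]].
  exact/mem_set.
exists (SigSub specJ) => [/JF //|x Ix /=].
by apply; exact: IJ.
Qed.

(** * Basic open sets of the spectrum *)

Implicit Types P : spectrum prec.

Lemma spectrumP P :
  [/\ proper_subset (\val P), round prec (\val P) & prime_filter (\val P)].
Proof. exact: set_mem (valP P). Qed.

Lemma spectrum_at_le x y : x <= y -> spectrum_at prec x `<=` spectrum_at prec y.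
Proof.
by move=> xy P; have [_ _ [/order_filterP[_ Ple _] _]] := spectrumP P; exact: Ple.
Qed.

Lemma spectrum_at0 : spectrum_at prec \bot = set0.
Proof.
apply/seteqP; split=> // P P0; have [nT _ _] := spectrumP P; apply: nT.
by apply/seteqP; split=> // x _; exact: spectrum_at_le (le0x x) _ P0.
Qed.

Lemma spectrum_atU x y :
  spectrum_at prec (x `|` y)%O = spectrum_at prec x `|` spectrum_at prec y.
Proof.
apply/seteqP; split=> [P Pxy|P [|]]; last 2 first.
- exact/spectrum_at_le/leUl.
- exact/spectrum_at_le/leUr.
have [_ _ [_ /order_idealP[_ _ IU]]] := spectrumP P.
apply: contrapT => /not_orP[nPx nPy].
exact: IU nPx nPy Pxy.
Qed.

Lemma open_spectrum_at x : open (spectrum_at prec x).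
Proof.
exists [set spectrum_at prec x]; last by rewrite bigcup_set1.
by move=> _ ->; apply: finI_from1; exists x.
Qed.

(** Points are down-directed, so finitely many subbasic sets through [P] contain a single one
    through [P]. *)
Lemma spectrum_at_basis (U : set (spectrum prec)) P : open U -> U P ->
  exists2 r, spectrum_at prec r P & spectrum_at prec r `<=` U.
Proof.
move=> [B Bfin <-] [V BV PV]; have [E ED EV] := Bfin _ BV; rewrite -EV in PV.
have [_ _ [/order_filterP[[z Pz] _ PI] _]] := spectrumP P.
suff H (s : seq (set (spectrum prec))) :
    (forall V, V \in s -> range (spectrum_at prec) V /\ V P) ->
    exists2 r, spectrum_at prec r P &
      forall V, V \in s -> spectrum_at prec r `<=` V.
  have [|r Pr rE] := H (enum_fset E).
    by move=> W EW; split; [exact: set_mem (ED _ EW)|exact: PV].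
  exists r => // Q Qr; exists V; first exact: BV.
  suff: V Q by []; rewrite -EV => W /rE; exact.
(* For the empty intersection any element [z] of [P] will do. *)
elim: s => [|V0 s IHs] Hs; first by exists z.
have [W sW|r Pr rs] := IHs; first by apply: Hs; rewrite inE sW orbT.
have [[x _ xV0] Px] := Hs V0 (mem_head _ _); rewrite -xV0 in Px.
have [y Py [yr yx]] := PI _ _ Pr Px.
exists y => // W; rewrite inE => /orP[/eqP->|/rs rW].
  by rewrite -xV0; exact: spectrum_at_le.
exact: subset_trans (spectrum_at_le yr) rW.
Qed.

Lemma finitely_covered_ideal (C : set (set (spectrum prec))) :
  order_ideal [set x | exists F : set (set (spectrum prec)),
    [/\ finite_set F, F `<=` C & spectrum_at prec x `<=` \bigcup_(U in F) U]].
Proof.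
apply/order_idealP; split.
- by exists set0; split=> //; rewrite spectrum_at0.
- move=> x y /spectrum_at_le xy [F [finF FC yF]].
  by exists F; split => //; exact: subset_trans yF.
move=> x y [F [finF FC xF]] [G [finG GC yG]]; exists (F `|` G); split.
- by rewrite finite_setU.
- by rewrite subUset.
- by rewrite spectrum_atU bigcup_setU; exact: setUSS.
Qed.

(** For [s ≺ r ≺ p], if [r <= q] failed, some point through [p] would avoid the principal ideal of
    [q]. *)
Lemma le_of_spectrum_at_sub p q :
  auxiliary prec -> interpolative prec -> prec_distributive prec ->
  approximating prec ->
  spectrum_at prec p `<=` spectrum_at prec q -> p <= q.
Proof.
move=> aux itp distr appr pq; apply/appr => s /itp[r sr rp].
suff rq : r <= q by exact: aux.1 (lexx s) sr rq.
apply: contrapT => nrq.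
have idq : order_ideal [set x | x <= q].
  apply/order_idealP; split; first exact: le0x.
    by move=> x y xy; exact: le_trans.
  by move=> x y xq yq; rewrite /= leUx xq.
have [P /pq Pq] := spectrum_at_avoiding_ideal aux itp distr idq rp nrq.
by move=> /(_ q (lexx q)).
Qed.

(** Serves the empty subcover. The pair [a ≺ b] excludes the one-element [S] with empty [prec],
    where the conclusion fails. Splitting [c ≺ b ∨ \bot] produces some [t ≺ \bot]. *)
Lemma prec_bot :
  auxiliary prec -> interpolative prec -> prec_distributive prec ->
  (exists a b, a ≺ b) -> forall q, \bot ≺ q.
Proof.
move=> [aux _] itp distr [a [b ab]] q.
have [c ac cb] := itp _ _ ab.
have cb0 : c ≺ (b `|` \bot)%O by rewrite joinx0.
have [_ [t [_ t0 _ _]]] := distr _ _ _ cb0 _ ac.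
exact: aux (le0x t) t0 (le0x q).
Qed.

End Spectrum.

Theorem proposition2p13 (d : Order.disp_t) (S : bJoinSemilatticeType d)
  (prec : S -> S -> Prop)
  (prec_nonempty : exists a b : S, prec a b)
  (predomS : distributive_join_predomain prec) (p q : S) :
  prec p q <-> way_inside (spectrum_at prec p) (spectrum_at prec q).
Proof.
have [[aux appr itp precU] distr] := predomS; split=> [pq C Copen qC|pq].
  apply: contrapT => np.
  have [P Pq PC] := spectrum_at_avoiding_ideal aux itp distr
    (finitely_covered_ideal C) pq np.
  have [U CU PU] := qC _ Pq.
  have [r Pr rU] := spectrum_at_basis (Copen _ CU) PU.
  (* [U] alone covers the basic set of [r], so [r] is in the ideal that [P] avoids. *)
  apply: (PC r) => //; exists [set U]; split; first exact: finite_set1.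
    by move=> _ ->.
  by rewrite bigcup_set1.
have [||F [/finite_seqP[s ->] FC pF]] :=
  pq [set spectrum_at prec r | r in [set r | prec r q]].
- by move=> _ [r _ <-]; exact: open_spectrum_at.
- move=> P Pq; have [_ /(_ _ Pq)[r Pr rq] _] := spectrumP P.
  by exists (spectrum_at prec r) => //; exists r.
suff [r rq sr] : exists2 r, prec r q &
    \bigcup_(U in [set` s]) U `<=` spectrum_at prec r.
  have pr := le_of_spectrum_at_sub aux itp distr appr (subset_trans pF sr).
  exact: aux.1 pr rq (lexx q).
elim: s FC {pF} => [|U s IHs] sC.
  by exists \bot; [exact: prec_bot|move=> P []].
have [V sV|r rq sr] := IHs; first by apply: sC; rewrite /= inE sV orbT.
have [x xq xU] := sC U (mem_head _ _).
(* Writing [q] as [q ∨ q] lets [prec] pass to the join. *)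
exists (x `|` r)%O; first by rewrite -(joinxx q); exact: precU.
rewrite spectrum_atU xU => P [V]; rewrite /= inE => /orP[/eqP->|sV] PV.
  by left.
by right; apply: sr; exists V.
Qed.
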